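(* Let $1<p<\infty$, let $n,k$ be positive integers, and let $f\colon\{-1,1\}^n\to\{-1,0,1\}$ satisfy $\mathbb{E}[fW_S]=0$ for all $S\subseteq\{1,\ldots,n\}$ with $|S|<k$. Then for all $t>0$, $$\|P_tf\|_p\le e^{-2tk\min\left(\frac{p-1}{p},\frac1p\right)}\|f\|_p .$$
   Context: $\{-1,1\}^n$ carries the uniform probability measure, $\mathbb{E}$ is expectation with respect to it, and $\|f\|_p=(\mathbb{E}|f|^p)^{1/p}$. For $S\subseteq\{1,\ldots,n\}$ and $x\in\{-1,1\}^n$ put $W_S(x)=\prod_{i\in S}x_i$ and $\widehat f(S)=\mathbb{E}[fW_S]$, so $f=\sum_S\widehat f(S)W_S$. For $t\ge0$, $P_tf=\sum_{S\subseteq\{1,\ldots,n\}}e^{-t|S|}\widehat f(S)W_S$. *)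

(* Defs.v *)
From HB Require Import structures.
From mathcomp Require Import all_boot all_order all_algebra.
From mathcomp Require Import reals sequences exp.

Set Implicit Arguments.
Unset Strict Implicit.
Unset Printing Implicit Defensive.

Import Order.TTheory GRing.Theory Num.Theory.
Local Open Scope ring_scope.

(* A point of {-1,1}^n is encoded by the signs of its coordinates: the boolean
   [x i] stands for the coordinate x_i = (-1) ^+ (x i), so that [false] is 1 and
   [true] is -1. *)
Definition cube (n : nat) : finType := {ffun 'I_n -> bool}.

Definition coord (R : realType) (n : nat) (x : cube n) (i : 'I_n) : R :=
  (-1) ^+ (x i).

Definition expect (R : realType) (n : nat) (g : cube n -> R) : R :=
  (\sum_(x : cube n) g x) / #|cube n|%:R.

Definition Lpnorm (R : realType) (n : nat) (p : R) (g : cube n -> R) : R :=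
  (expect (fun x => `|g x| `^ p)) `^ (1 / p).

Definition walsh (R : realType) (n : nat) (S : {set 'I_n}) (x : cube n) : R :=
  \prod_(i in S) coord R x i.

Definition fourier (R : realType) (n : nat) (f : cube n -> R)
    (S : {set 'I_n}) : R :=
  expect (fun x => f x * walsh R S x).

Definition heat (R : realType) (n : nat) (t : R) (f : cube n -> R)
    (x : cube n) : R :=
  \sum_(S : {set 'I_n}) expR (- t * #|S|%:R) * fourier f S * walsh R S x.

(* Main.v *)
(** For all p the proof reduces to two facts about g = P_t f and
    mu = E|f|^p = E|f| = E f^2 (f is {-1,0,1}-valued): the L^2 decay
    E g^2 <= e^(-2tk) mu, which is Parseval, and the contractivity of P_t, which
    is averaging against a nonnegative kernel of mean 1.  If p >= 2, then
    |g| <= 1 gives |g|^p <= g^2.  If p < 2, one interpolates between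
    E|g| <= mu and e^(2tk) E g^2 <= mu by Young's inequality
    l^(p-1) a^p = a^(2-p) (l a^2)^(p-1) <= (2-p) a + (p-1) l a^2. *)
Require Import Defs.
From mathcomp Require Import all_boot all_order all_algebra.
From mathcomp Require Import reals sequences exp.
From mathcomp Require Import ring lra.

Import Order.TTheory GRing.Theory Num.Theory.
Local Open Scope ring_scope.

Lemma card_cube_gt0 (R : realType) (n : nat) : (0 : R) < #|cube n|%:R.
Proof. by rewrite ltr0n card_ffun card_bool expn_gt0. Qed.

Lemma eq_expect (R : realType) (n : nat) (g h : cube n -> R) :
  (forall x, g x = h x) -> expect g = expect h.
Proof. by move=> gh; congr (_ / _); apply: eq_bigr. Qed.

Lemma le_expect (R : realType) (n : nat) (g h : cube n -> R) :
  (forall x, g x <= h x) -> expect g <= expect h.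
Proof.
move=> gh; rewrite ler_pM2r ?invr_gt0 ?card_cube_gt0 //.
exact: ler_sum.
Qed.

Lemma expect_ge0 (R : realType) (n : nat) (g : cube n -> R) :
  (forall x, 0 <= g x) -> 0 <= expect g.
Proof. by move=> g0; rewrite divr_ge0 ?ler0n// sumr_ge0. Qed.

Lemma expectD (R : realType) (n : nat) (g h : cube n -> R) :
  expect (fun x => g x + h x) = expect g + expect h.
Proof. by rewrite /expect big_split mulrDl. Qed.

Lemma expectZ (R : realType) (n : nat) (c : R) (g : cube n -> R) :
  expect (fun x => c * g x) = c * expect g.
Proof. by rewrite /expect -mulr_sumr mulrA. Qed.

Lemma expect_sum (R : realType) (n : nat) (I : finType)
    (g : I -> cube n -> R) :
  expect (fun x => \sum_i g i x) = \sum_i expect (g i).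
Proof. by rewrite /expect exchange_big mulr_suml. Qed.

Lemma exchange_expect (R : realType) (n : nat) (g : cube n -> cube n -> R) :
  expect (fun x => expect (g x)) = expect (fun y => expect (g^~ y)).
Proof. by rewrite /expect -!mulr_suml exchange_big. Qed.

(** Independence of the coordinates: distributing a product of n two-term sums enumerates the points
    of the cube, and the normalisation 2^n splits into one factor 2 per coordinate. *)
Lemma expect_prod (R : realType) (n : nat) (F : 'I_n -> bool -> R) :
  expect (fun x : cube n => \prod_i F i (x i)) =
  \prod_i ((F i false + F i true) / 2).
Proof.
rewrite big_split /= prodr_const card_ord exprVn /expect.
rewrite card_ffun card_bool card_ord natrX; congr (_ / _).
under [RHS]eq_bigr do rewrite addrC -big_bool.
by rewrite bigA_distr_bigA.
Qed.

Lemma walsh_prod (R : realType) (n : nat) (S : {set 'I_n}) (x : cube n) :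
  walsh R S x = \prod_i (if i \in S then Defs.coord R x i else 1).
Proof. by rewrite /walsh big_mkcond. Qed.

(** By independence the expectation factors over coordinates. A coordinate lying in exactly one of S
    and T contributes a factor of mean 0; every other coordinate contributes 1. *)
Lemma expect_walshM (R : realType) (n : nat) (S T : {set 'I_n}) :
  expect (fun x => walsh R S x * walsh R T x) = (S == T)%:R.
Proof.
pose F i (b : bool) : R :=
  (if i \in S then (-1) ^+ b else 1) * (if i \in T then (-1) ^+ b else 1).
transitivity (\prod_i ((F i false + F i true) / 2)).
  rewrite -expect_prod; apply: eq_expect => x.
  by rewrite (walsh_prod R n S) (walsh_prod R n T) -big_split.
rewrite {}/F; have [->|neqST] := eqVneq S T.
  by apply: big1 => i _; case: ifP => _; rewrite ?expr0 ?expr1; field.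
have [i Hi] : exists i, (i \in S) != (i \in T).
  apply/existsP; apply: contraNT neqST => /existsPn H.
  by apply/eqP/setP => i; apply/eqP; have := H i; rewrite negbK.
rewrite (bigD1 i) //= [X in X * _](_ : _ = 0) ?mul0r //.
by move: Hi; case: (i \in S); case: (i \in T) => //= _; rewrite ?expr0 ?expr1; field.
Qed.

Lemma parseval_heat (R : realType) (n : nat) (t : R) (f : cube n -> R) :
  expect (fun x => heat t f x ^+ 2) =
  \sum_(S : {set 'I_n}) expR (- t * #|S|%:R) ^+ 2 * fourier f S ^+ 2.
Proof.
pose a (S : {set 'I_n}) := expR (- t * #|S|%:R) * fourier f S.
transitivity (\sum_S \sum_T a S * a T *
    expect (fun x : cube n => walsh R S x * walsh R T x)).
  under [RHS]eq_bigr do under eq_bigr do rewrite -expectZ.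
  under [RHS]eq_bigr do rewrite -expect_sum.
  rewrite -expect_sum; apply: eq_expect => x.
  rewrite expr2 big_distrlr /=; apply: eq_bigr => S _; apply: eq_bigr => T _.
  by rewrite /a; ring.
apply: eq_bigr => S _; rewrite (bigD1 S) //= expect_walshM eqxx mulr1.
rewrite big1 ?addr0 => [|T neqTS]; first by rewrite /a; ring.
by rewrite expect_walshM eq_sym (negbTE neqTS) mulr0.
Qed.

(** The density, relative to the uniform measure, of the noise operator with correlation e^(-t). In
    product form, nonnegativity and mean 1 can be checked one coordinate at a time. *)
Definition noise_kernel (R : realType) (n : nat) (t : R) (x y : cube n) : R :=
  \prod_i (1 + expR (- t) * (Defs.coord R x i * Defs.coord R y i)).

Lemma noise_kernelC (R : realType) (n : nat) (t : R) (x y : cube n) :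
  noise_kernel R n t x y = noise_kernel R n t y x.
Proof. by apply: eq_bigr => i _; rewrite [Defs.coord R x i * _]mulrC. Qed.

Lemma noise_kernel_ge0 (R : realType) (n : nat) (t : R) (x y : cube n) :
  0 <= t -> 0 <= noise_kernel R n t x y.
Proof.
move=> t0; apply: prodr_ge0 => i _.
have e0 := expR_gt0 (- t).
have e1 : expR (- t) <= 1 by rewrite expR_le1 oppr_le0.
by rewrite /Defs.coord; case: (x i); case: (y i); rewrite ?expr0 ?expr1; lra.
Qed.

Lemma expect_noise_kernel (R : realType) (n : nat) (t : R) (x : cube n) :
  expect (noise_kernel R n t x) = 1.
Proof.
rewrite (expect_prod _ _
  (fun i b => 1 + expR (- t) * (Defs.coord R x i * (-1) ^+ b))).
by apply: big1 => i _; rewrite expr0 expr1; field.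
Qed.

Lemma noise_kernelE (R : realType) (n : nat) (t : R) (x y : cube n) :
  noise_kernel R n t x y =
  \sum_(S : {set 'I_n}) expR (- t * #|S|%:R) * (walsh R S x * walsh R S y).
Proof.
(* After the swap, the set S of the expanded product collects the coordinates where the e^(-t) term
   is chosen, which gives e^(-t|S|). *)
rewrite /noise_kernel; under eq_bigr do rewrite addrC.
rewrite bigA_distr; apply: eq_bigr => S _.
rewrite -big_mkcond /= big_split big_split /=; congr (_ * _).
by rewrite prodr_const -expRM_natl mulrC.
Qed.

Lemma heatE (R : realType) (n : nat) (t : R) (f : cube n -> R) (x : cube n) :
  heat t f x = expect (fun y => f y * noise_kernel R n t x y).
Proof.
under [RHS]eq_expect do rewrite noise_kernelE mulr_sumr.
rewrite expect_sum; apply: eq_bigr => S _.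
rewrite /fourier mulrAC -expectZ; apply: eq_expect => y; ring.
Qed.

(** This is the Walsh expansion of f. At t = 0 the kernel is 2^n times the indicator of y = x: each
    factor is 2 where x and y agree and 0 where they differ. *)
Lemma heat0 (R : realType) (n : nat) (f : cube n -> R) (x : cube n) :
  heat 0 f x = f x.
Proof.
rewrite heatE /expect (bigD1 x) //= big1 ?addr0 => [|y neqyx].
  have -> : noise_kernel R n 0 x x = #|cube n|%:R.
    rewrite card_ffun card_bool natrX -prodr_const.
    apply: eq_bigr => i _; rewrite oppr0 expR0 /Defs.coord.
    by case: (x i); rewrite ?expr0 ?expr1; ring.
  by rewrite mulfK // lt0r_neq0 // card_cube_gt0.
have [i Hi] : exists i, y i != x i.
  apply/existsP; apply: contraNT neqyx => /existsPn H.
  by apply/eqP/ffunP => i; apply/eqP; have := H i; rewrite negbK.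
have K0 : 1 + expR (- 0) * (Defs.coord R x i * Defs.coord R y i) = 0.
  rewrite oppr0 expR0 /Defs.coord.
  by move: Hi; case: (x i); case: (y i) => //= _; rewrite ?expr0 ?expr1; ring.
by rewrite /noise_kernel (bigD1 i) //= K0 mul0r mulr0.
Qed.

Lemma norm_heat_le (R : realType) (n : nat) (t : R) (f : cube n -> R)
    (x : cube n) : 0 <= t ->
  `|heat t f x| <= expect (fun y => `|f y| * noise_kernel R n t x y).
Proof.
move=> t0; rewrite heatE /expect normrM normfV normr_nat.
rewrite ler_pM2r ?invr_gt0 ?card_cube_gt0 //.
apply: le_trans (ler_norm_sum _ _ _) _; apply: ler_sum => y _.
by rewrite normrM (ger0_norm (noise_kernel_ge0 _ _ _ _ _ t0)).
Qed.

Lemma norm_heat_le1 (R : realType) (n : nat) (t : R) (f : cube n -> R)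
    (x : cube n) :
  0 <= t -> (forall y, `|f y| <= 1) -> `|heat t f x| <= 1.
Proof.
move=> t0 f1; apply: le_trans (norm_heat_le _ _ _ _ _ t0) _.
rewrite -(expect_noise_kernel R n t x); apply: le_expect => y.
by rewrite ler_piMl // noise_kernel_ge0.
Qed.

(** After exchanging the expectations, the kernel is averaged in its first variable; by symmetry
    this mean is also 1. *)
Lemma expect_norm_heat_le (R : realType) (n : nat) (t : R) (f : cube n -> R) :
  0 <= t -> expect (fun x => `|heat t f x|) <= expect (fun x => `|f x|).
Proof.
move=> t0.
apply: le_trans (le_expect _ _ _ _ (fun x => norm_heat_le _ _ _ f x t0)) _.
rewrite exchange_expect; apply: le_expect => y.
rewrite expectZ (eq_expect _ _ _ (noise_kernel R n t y)).
  by rewrite expect_noise_kernel mulr1.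
by move=> x; apply: noise_kernelC.
Qed.

(** With f written as [heat 0 f], Parseval applies to both sides and the sums compare term by term:
    levels below k vanish, and on the others e^(2tk) e^(-2t|S|) <= 1. *)
Lemma expect_heat_sqr_le (R : realType) (n k : nat) (t : R) (f : cube n -> R) :
  0 <= t -> (forall S : {set 'I_n}, (#|S| < k)%N -> fourier f S = 0) ->
  expR (2 * t * k%:R) * expect (fun x => heat t f x ^+ 2) <=
    expect (fun x => f x ^+ 2).
Proof.
move=> t0 fk.
rewrite -(eq_expect _ _ (fun x => heat 0 f x ^+ 2) (fun x => f x ^+ 2)) => [|x]; last first.
  by rewrite heat0.
rewrite !parseval_heat mulr_sumr; apply: ler_sum => S _.
rewrite oppr0 mul0r expR0 expr1n mul1r.
have [/fk ->|kS] := ltnP #|S| k; first by rewrite expr0n /= !mulr0.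
rewrite mulrA ler_piMl ?sqr_ge0 // -expRM_natl -expRD expR_le1.
have : t * k%:R <= t * #|S|%:R by rewrite ler_wpM2l // ler_nat.
lra.
Qed.

Lemma young_powR (R : realType) (a l p : R) :
  0 <= a -> 0 <= l -> 1 < p -> p < 2 ->
  l `^ (p - 1) * a `^ p <= (2 - p) * a + (p - 1) * (l * a ^+ 2).
Proof.
move=> a0 l0 p1 p2.
have s0 : 0 < 2 - p by lra.
have r0 : 0 < p - 1 by lra.
(* The conjugate exponents are 1/(2-p) and 1/(p-1), whose reciprocals sum to 1; they undo the powers
   2-p and p-1. *)
have := conjugate_powR (powR_ge0 a (2 - p)) (powR_ge0 (l * a ^+ 2) (p - 1)).
move=> /(_ (2 - p)^-1 (p - 1)^-1); rewrite !invr_gt0 !invrK.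
move=> /(_ s0 r0) H.
have {H} := H ltac:(ring).
rewrite -!powRrM !divff ?lt0r_neq0 // !powRr1 ?mulr_ge0 ?sqr_ge0 //.
rewrite powRM ?sqr_ge0 // -(powR_mulrn _ a0) -powRrM mulrCA -powRD; last first.
  (* Since [a] may be 0, adding the exponents requires their sum p to be nonzero. *)
  by apply/implyP => /eqP; lra.
have -> : 2 - p + 2 * (p - 1) = p by ring.
by rewrite powR_mulrn // [a * _]mulrC [_ * (p - 1)]mulrC.
Qed.

Lemma Lpnorm_le (R : realType) (n : nat) (p c : R) (g h : cube n -> R) :
  0 < p ->
  expect (fun x => `|g x| `^ p) <= expR (c * p) * expect (fun x => `|h x| `^ p) ->
  Lpnorm p g <= expR c * Lpnorm p h.
Proof.
move=> p0 gh.
have E0 q : 0 <= expect (fun x : cube n => `|q x| `^ p).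
  by apply: expect_ge0 => x; apply: powR_ge0.
have -> : expR c = expR (c * p) `^ (1 / p).
  by rewrite -expRM; congr expR; field; rewrite lt0r_neq0.
rewrite /Lpnorm -powRM ?expR_ge0 //; apply: ge0_ler_powR => //.
- by rewrite divr_ge0 // ltW.
- by rewrite nnegrE.
- by rewrite nnegrE mulr_ge0 ?expR_ge0.
Qed.

Theorem theorem1p3 (R : realType) (p : R) (n k : nat) (f : cube n -> R)
  (hp : 1 < p) (hn : (0 < n)%N) (hk : (0 < k)%N)
  (hf : forall x : cube n, f x = -1 \/ f x = 0 \/ f x = 1)
  (hfk : forall S : {set 'I_n}, (#|S| < k)%N ->
     expect (fun x => f x * walsh R S x) = 0) :
  forall t : R, 0 < t ->
    Lpnorm p (heat t f) <=
      expR (- 2 * t * k%:R * Num.min ((p - 1) / p) (1 / p)) * Lpnorm p f.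
Proof.
move=> t t0.
have p0 : 0 < p by lra.
have fpE x : `|f x| `^ p = `|f x|.
  have [->|[->|->]] := hf x; rewrite ?normrN ?normr0 ?normr1 ?powR1 //.
  (* At zeros of f this needs p to be nonzero, because 0 to the power 0 is 1. *)
  by rewrite powR0 // lt0r_neq0.
have f2E x : f x ^+ 2 = `|f x|.
  by have [->|[->|->]] := hf x; rewrite ?normrN ?normr0 ?normr1; ring.
apply: Lpnorm_le => //.
rewrite (eq_expect _ _ (fun x => `|f x| `^ p) (fun x => `|f x|)) //.
set mu := expect (fun x => `|f x|).
have L1 : expect (fun x => `|heat t f x|) <= mu.
  by apply: expect_norm_heat_le; apply: ltW.
have L2 : expR (2 * t * k%:R) * expect (fun x => heat t f x ^+ 2) <= mu.
  rewrite /mu -(eq_expect _ _ _ _ f2E); apply: expect_heat_sqr_le => //.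
  exact: ltW.
have move_exp (c E : R) : expR c * E <= mu -> E <= expR (- c) * mu.
  by move=> H; rewrite expRN mulrC ler_pdivlMr ?expR_gt0 // mulrC.
have [p2|p2] := leP 2 p.
- have -> : Num.min ((p - 1) / p) (1 / p) = 1 / p.
    by apply: min_r; rewrite ler_pM2r ?invr_gt0 //; lra.
  have -> : - 2 * t * k%:R * (1 / p) * p = - (2 * t * k%:R).
    by field; rewrite lt0r_neq0.
  apply: move_exp; apply: le_trans L2.
  rewrite ler_wpM2l ?expR_ge0 //; apply: le_expect => x.
  rewrite -real_normK ?num_real // -powR_mulrn //.
  have h1 : `|heat t f x| <= 1.
    apply: norm_heat_le1 => [|y]; first exact: ltW.
    by have [->|[->|->]] := hf y; rewrite ?normrN ?normr0 ?normr1.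
  (* Powers decrease in the exponent for bases in (0, 1]; base 0 is treated apart. *)
  have [->|h0] := eqVneq (heat t f x) 0.
    by rewrite normr0 !powR0 // ?lt0r_neq0.
  by apply: ger_powR => //; rewrite normr_gt0 h0 h1.
- have -> : Num.min ((p - 1) / p) (1 / p) = (p - 1) / p.
    by apply: min_l; rewrite ler_pM2r ?invr_gt0 //; lra.
  have -> : - 2 * t * k%:R * ((p - 1) / p) * p = - (2 * t * k%:R * (p - 1)).
    by field; rewrite lt0r_neq0.
  (* The factor e^(2tk(p-1)) becomes l^(p-1) with l = e^(2tk), so that Young's inequality applies
     pointwise. *)
  apply: move_exp; rewrite expRM -expectZ.
  have := le_expect _ _ _ _ (fun x => young_powR _ _ _ p
    (normr_ge0 (heat t f x)) (expR_ge0 (2 * t * k%:R)) hp p2).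
  move=> /le_trans; apply; rewrite expectD !expectZ.
  rewrite (eq_expect _ _ (fun x => `|heat t f x| ^+ 2)
             (fun x => heat t f x ^+ 2)) => [|x]; last first.
    by rewrite real_normK ?num_real.
  have A : (2 - p) * expect (fun x => `|heat t f x|) <= (2 - p) * mu.
    by rewrite ler_wpM2l //; lra.
  have B := ler_wpM2l (ltW (_ : 0 < p - 1)) L2.
  have {}B := B ltac:(lra).
  (* The weights 2-p and p-1 sum to 1, so the two bounds by [mu] average to [mu]. *)
  by apply: le_trans (lerD A B) _; rewrite -mulrDl; lra.
Qed.
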